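(* Let $\Gamma$ be an inverse semigroup satisfying the trapping condition (T). Then $G_m(\Gamma)^{(0)}$ is closed in $G_u(\Gamma)^{(0)}$.
   Context: In an inverse semigroup, $x\prec y$ means $xy^{-1}=xx^{-1}$ (natural partial order); $\Gamma^{(0)}$ is the set of idempotents. The symbol $0$ denotes the (unique) element $z$ with $z\prec x$ for all $x$, if it exists; conditions ''$\neq0$'' are vacuous otherwise. An element $x$ is minimal if $x\neq0$ and $y\prec x$, $y\ne0$ implies $y=x$. For $x,x_1,\ldots,x_n\in\Gamma$ write $x<(x_1,\ldots,x_n)$ if for every $y\prec x$, $y\ne0$, there exist $z\in\Gamma$, $z\neq0$, and $j\in\{1,\ldots,n\}$ with $z\prec y$ and $z\prec x_j$. Condition (T): $\Gamma$ contains a zero and for every $p,q\in\Gamma^{(0)}$ with $q\prec p$ there exist $p_1,\ldots,p_n\in\Gamma^{(0)}$ with $p_j\prec p$ for $j=1,\ldots,n$ such that $p<(p_1,\ldots,p_n,q)$ and for every $j\in\{1,\ldots,n\}$ either $p_j\prec q$ or $p_jq=0$. A subset $A\subset\Gamma$ is directed if it is nonempty and any two elements of $A$ have a common $\prec$-lower bound in $A$. For directed sets write $A\prec B$ if for every $b\in B$ there is $a\in A$ with $a\prec b$, and $A\sim B$ if $A\prec B$ and $B\prec A$. $\mathcal{O}(\Gamma)$ is the set of $\sim$-classes $[A]$ of directed sets; with $[A][B]=[AB]$ and $[A]^{-1}=[A^{-1}]$ (elementwise) it is an inverse semigroup whose natural order is $[A]\prec[B]\iff A\prec B$. For $x\in\Gamma$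 write $x$ also for $[\{x\}]$. $G_u(\Gamma)$ is the groupoid with underlying set $\mathcal{O}(\Gamma)$, the inversion of $\mathcal{O}(\Gamma)$, and product $XY$ defined iff $X^{-1}X=YY^{-1}$. For $x_1,\ldots,x_n\prec x$ in $\Gamma$ ($n\ge0$), with $U_x=\{X:X\prec x\}$, put $U_{x;x_1,\ldots,x_n}=U_x\cap U_{x_1}^c\cap\cdots\cap U_{x_n}^c$; these sets are a basis of the topology of $G_u(\Gamma)$. $G_m(\Gamma)$ is the subgroupoid of $G_u(\Gamma)$ consisting of the minimal elements of $\mathcal{O}(\Gamma)$, with the subspace topology. For a groupoid $G$, $G^{(0)}$ is its set of units. *)

(* Defs.v *)
From HB Require Import structures.
From mathcomp Require Import all_boot.
From mathcomp Require Import all_classical topology.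

Set Implicit Arguments.
Unset Strict Implicit.
Unset Printing Implicit Defensive.

Local Open Scope classical_set_scope.
Local Open Scope group_scope.
Local Open Scope quotient_scope.

(* MathComp's [inv] requires a unit element, hence the separate [sinv]. *)
HB.mixin Record Semigroup_isInverse S of Semigroup S := {
  sinv : S -> S;
  mulgKs : forall x : S, x * sinv x * x = x;
  mulsKg : forall x : S, sinv x * x * sinv x = sinv x;
  sinv_uniq : forall x y : S, x * y * x = x -> y * x * y = y -> y = sinv x
}.

#[short(type="invSemigroupType")]
HB.structure Definition InvSemigroup := {S of Semigroup_isInverse S & Semigroup S}.

Bind Scope group_scope with InvSemigroup.sort.

Definition idem (S : semigroupType) (x : S) : Prop := x * x = x.

Definition nat_le (S : invSemigroupType) (x y : S) : Prop :=
  x * sinv y = x * sinv x.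

Notation "x \prec y" := (nat_le x y) (at level 70, no associativity).

Definition is_zero (S : invSemigroupType) (z : S) : Prop :=
  forall x : S, z \prec x.

Definition minimal (S : invSemigroupType) (x : S) : Prop :=
  ~ is_zero x /\ forall y : S, y \prec x -> ~ is_zero y -> y = x.

(* The relation x < (x_1, ..., x_n), where s is the list of the x_i. *)
Definition trapped (S : invSemigroupType) (x : S) (s : seq S) : Prop :=
  forall y : S, y \prec x -> ~ is_zero y ->
    exists z w : S, [/\ ~ is_zero z, w \in s, z \prec y & z \prec w].

Definition condition_T (S : invSemigroupType) : Prop :=
  (exists z : S, is_zero z) /\
  forall p q : S, idem p -> idem q -> q \prec p ->
    exists ps : seq S,
      [/\ forall r, r \in ps -> idem r /\ r \prec p,
          trapped p (rcons ps q) &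
          forall r, r \in ps -> r \prec q \/ is_zero (r * q)].

Section CommutingIdempotents.
Variables (S : semigroupType) (i : S -> S).
Hypothesis iK : forall x : S, x * i x * x = x.
Hypothesis Ki : forall x : S, i x * x * i x = i x.
Hypothesis eC : forall e f : S, idem e -> idem f -> e * f = f * e.

Lemma comm_idem_inv_uniq (x y : S) :
  x * y * x = x -> y * x * y = y -> y = i x.
Proof.
move=> xyx yxy.
have i1 : idem (x * i x) by rewrite /idem mulgA iK.
have i2 : idem (i x * x) by rewrite /idem mulgA Ki.
have i3 : idem (x * y) by rewrite /idem mulgA xyx.
have i4 : idem (y * x) by rewrite /idem mulgA yxy.
transitivity (i x * x * y).
  rewrite -[LHS]yxy -{1}(iK x).
  have -> : y * (x * i x * x) * y = (y * x) * (i x * x) * y by rewrite !mulgA.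
  by rewrite (eC i4 i2) -!mulgA (mulgA y) yxy.
suff <- : i x * (x * y * x) * i x = i x * x * y by rewrite xyx Ki.
have -> : i x * (x * y * x) * i x = i x * ((x * y) * (x * i x)).
  by rewrite !mulgA.
by rewrite (eC i3 i1) !mulgA Ki.
Qed.

End CommutingIdempotents.

Section Theory.
Variable S : invSemigroupType.
Implicit Types x y z e f : S.

Lemma sinvK x : sinv (sinv x) = x.
Proof. by apply/esym/sinv_uniq; [exact: mulsKg | exact: mulgKs]. Qed.

Lemma idem_sinv e : idem e -> sinv e = e.
Proof. by move=> ee; apply/esym/sinv_uniq; rewrite !ee. Qed.

Lemma idem_mulgs x : idem (x * sinv x).
Proof. by rewrite /idem mulgA mulgKs. Qed.

Lemma idem_mulsg x : idem (sinv x * x).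
Proof. by rewrite /idem mulgA mulsKg. Qed.

Lemma idem_mul_idem e f : idem e -> idem f -> idem (e * f).
Proof.
move=> ee ff; set x := sinv (e * f).
have h1 : e * f * x * (e * f) = e * f := mulgKs _.
have h2 : x * (e * f) * x = x := mulsKg _.
have xE : f * x * e = x.
  apply: sinv_uniq.
    rewrite -[RHS]h1 !mulgA -(mulgA e f f) ff -(mulgA _ e e) ee //.
  rewrite -[in RHS]h2 !mulgA -(mulgA _ e e) ee -(mulgA _ f f) ff //.
have xx : idem x.
  rewrite /idem -{1 2}xE.
  have -> : f * x * e * (f * x * e) = f * (x * (e * f) * x) * e.
    by rewrite !mulgA.
  by rewrite h2.
by have := idem_sinv xx; rewrite /x sinvK => ->.
Qed.

Lemma idemC e f : idem e -> idem f -> e * f = f * e.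
Proof.
move=> ee ff; have h := idem_mul_idem ee ff; have h' := idem_mul_idem ff ee.
rewrite -[LHS](idem_sinv h); apply/esym/sinv_uniq.
  rewrite -[RHS]h !mulgA -(mulgA _ f f) ff -(mulgA _ e e) ee //.
rewrite -[RHS]h' !mulgA -(mulgA _ e e) ee -(mulgA _ f f) ff //.
Qed.

Lemma idem_conj x e : idem e -> idem (x * e * sinv x).
Proof.
move=> ee; rewrite /idem.
have -> : x * e * sinv x * (x * e * sinv x) =
          x * (e * (sinv x * x)) * (e * sinv x) by rewrite !mulgA.
rewrite (idemC ee (idem_mulsg x)) !mulgA mulgKs -(mulgA x e e) ee //.
Qed.

Lemma sinvM x y : sinv (x * y) = sinv y * sinv x.
Proof.
apply/esym/sinv_uniq.
  have -> : x * y * (sinv y * sinv x) * (x * y) =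
            x * ((y * sinv y) * (sinv x * x)) * y by rewrite !mulgA.
  by rewrite (idemC (idem_mulgs y) (idem_mulsg x)) !mulgA mulgKs -!mulgA
             (mulgA y) mulgKs.
have -> : sinv y * sinv x * (x * y) * (sinv y * sinv x) =
          sinv y * ((sinv x * x) * (y * sinv y)) * sinv x by rewrite !mulgA.
by rewrite (idemC (idem_mulsg x) (idem_mulgs y)) !mulgA mulsKg -!mulgA
           (mulgA (sinv x)) mulsKg.
Qed.

Lemma nat_leEl x y : x \prec y <-> exists2 e, idem e & x = e * y.
Proof.
split=> [xy|[e ee ->]].
  have yx : y * sinv x = x * sinv x.
    by rewrite -[in LHS](sinvK y) -sinvM xy (idem_sinv (idem_mulgs x)).
  exists (y * (sinv x * x) * sinv y); first exact/idem_conj/idem_mulsg.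
  have -> : y * (sinv x * x) * sinv y * y = y * ((sinv x * x) * (sinv y * y)).
    by rewrite !mulgA.
  by rewrite (idemC (idem_mulsg x) (idem_mulsg y)) !mulgA mulgKs yx mulgKs.
rewrite /nat_le sinvM (idem_sinv ee) -!mulgA.
rewrite (mulgA y) (idemC (idem_mulgs y) ee).
by rewrite [RHS]mulgA ee.
Qed.

Lemma nat_leEr x y : x \prec y <-> exists2 e, idem e & x = y * e.
Proof.
rewrite nat_leEl; split=> -[e ee ->].
  exists (sinv y * e * y); first by have := idem_conj (sinv y) ee; rewrite sinvK.
  have -> : y * (sinv y * e * y) = (y * sinv y) * e * y by rewrite !mulgA.
  by rewrite (idemC (idem_mulgs y) ee) -mulgA mulgKs.
exists (y * e * sinv y); first exact: idem_conj.
have -> : y * e * sinv y * y = y * (e * (sinv y * y)) by rewrite !mulgA.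
by rewrite (idemC ee (idem_mulsg y)) !mulgA mulgKs.
Qed.

Lemma nat_le_refl x : x \prec x.
Proof. by []. Qed.

Lemma nat_le_trans y x z : x \prec y -> y \prec z -> x \prec z.
Proof.
move=> /nat_leEl[e ee ->] /nat_leEl[f ff ->].
by apply/nat_leEl; exists (e * f); rewrite ?mulgA//; exact: idem_mul_idem.
Qed.

Lemma nat_leE x y : x \prec y <-> x = x * sinv x * y.
Proof.
split=> [/nat_leEl[e ee ->]|h]; last first.
  by apply/nat_leEl; exists (x * sinv x); [exact: idem_mulgs|].
rewrite sinvM (idem_sinv ee).
have -> : e * y * (sinv y * e) * y = e * ((y * sinv y) * e) * y.
  by rewrite !mulgA.
by rewrite (idemC (idem_mulgs y) ee) !mulgA ee -!mulgA (mulgA y) mulgKs.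
Qed.

Lemma nat_leE' x y : x \prec y <-> x = y * (sinv x * x).
Proof.
split=> [/nat_leEr[e ee ->]|h]; last first.
  by apply/nat_leEr; exists (sinv x * x); [exact: idem_mulsg|].
rewrite sinvM (idem_sinv ee).
have -> : y * (e * sinv y * (y * e)) = y * (e * (sinv y * y)) * e.
  by rewrite !mulgA.
by rewrite (idemC ee (idem_mulsg y)) !mulgA mulgKs -mulgA ee.
Qed.

Lemma nat_le_anti x y : x \prec y -> y \prec x -> x = y.
Proof.
move=> /nat_leE xy /nat_leEl[f ff yE].
by rewrite {1}xy yE mulgA (idemC (idem_mulgs x) ff) -mulgA mulgKs.
Qed.

Lemma nat_le_inv x y : x \prec y -> sinv x \prec sinv y.
Proof.
move=> /nat_leEl[e ee ->]; apply/nat_leEr; exists e => //.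
by rewrite sinvM (idem_sinv ee).
Qed.

Lemma nat_le_mul x x' y y' : x \prec x' -> y \prec y' -> x * y \prec x' * y'.
Proof.
move=> /nat_leEl[e ee ->] /nat_leEr[f ff ->].
apply: (@nat_le_trans (x' * y' * f)); last by apply/nat_leEr; exists f.
by apply/nat_leEl; exists e => //; rewrite !mulgA.
Qed.

Lemma nat_le_idem e f : f \prec e -> idem e -> idem f.
Proof. by move=> /nat_leEl[g gg ->]; exact: idem_mul_idem. Qed.

Lemma nat_le_mull x e : idem e -> e * x \prec x.
Proof. by move=> ee; apply/nat_leEl; exists e. Qed.

Lemma nat_le_mulr x e : idem e -> x * e \prec x.
Proof. by move=> ee; apply/nat_leEr; exists e. Qed.

Lemma is_zero_le x z : is_zero z -> x \prec z -> is_zero x.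
Proof. by move=> z0 xz y; exact: nat_le_trans xz (z0 y). Qed.

Lemma is_zero_inv z : is_zero z -> is_zero (sinv z).
Proof. by move=> z0 x; have := nat_le_inv (z0 (sinv x)); rewrite sinvK. Qed.

Lemma is_zero_mull z y : is_zero z -> is_zero (z * y).
Proof.
move=> z0 w; apply: (@nat_le_trans (w * sinv y * y)).
  by apply: nat_le_mul; [exact: z0|].
by rewrite -mulgA; apply/nat_le_mulr/idem_mulsg.
Qed.

Lemma minimal_inv x : minimal x -> minimal (sinv x).
Proof.
move=> [x0 mx]; split=> [/is_zero_inv|y yx y0]; first by rewrite sinvK.
rewrite -(mx (sinv y)) ?sinvK//; last first.
  by move=> /is_zero_inv; rewrite sinvK.
by have := nat_le_inv yx; rewrite sinvK.
Qed.

Lemma minimal_mul x y :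
  sinv x * x = y * sinv y -> minimal x -> minimal (x * y).
Proof.
move=> xy [x0 mx]; have xyK : x * y * sinv y = x by rewrite -mulgA -xy mulgA mulgKs.
split=> [xy0|w wxy w0]; first by apply: x0; rewrite -xyK; exact: is_zero_mull.
have wK : w * sinv y * y = w.
  have /nat_leEr[f ff ->] := wxy.
  rewrite -!mulgA; congr (_ * _).
  by rewrite (idemC ff (idem_mulsg y)) 2!mulgA mulgKs.
rewrite -[LHS]wK (mx (w * sinv y))//.
  by rewrite -[X in _ \prec X]xyK; apply: nat_le_mul.
by move=> wy0; apply: w0; rewrite -wK; exact: is_zero_mull.
Qed.

End Theory.

Section Directed.
Variable S : invSemigroupType.

Definition directed (A : set S) : Prop :=
  A !=set0 /\
  forall a b, A a -> A b -> exists c, [/\ A c, c \prec a & c \prec b].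

Definition dset : Type := [set A : set S | directed A].
HB.instance Definition _ := Choice.on dset.

Definition dset_set (A : dset) : set S := set_val A.
Coercion dset_set : dset >-> set.

Lemma dsetP (A : dset) : directed A.
Proof. exact: set_valP A. Qed.

Definition mk_dset (A : set S) (dA : directed A) : dset := SigSub (mem_set dA).

Lemma mk_dsetE (A : set S) (dA : directed A) : mk_dset dA = A :> set S.
Proof. by []. Qed.

Definition dle (A B : set S) : Prop := forall b, B b -> exists2 a, A a & a \prec b.

Lemma dle_refl A : dle A A. Proof. by move=> a Aa; exists a. Qed.

Lemma dle_trans B A C : dle A B -> dle B C -> dle A C.
Proof.
move=> AB BC c /BC[b /AB[a Aa ab] bc]; exists a => //; exact: nat_le_trans bc.
Qed.

Definition dequiv (A B : dset) : bool := `[< dle A B /\ dle B A >].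

Lemma dequiv_refl : reflexive dequiv.
Proof. by move=> A; apply/asboolP; split; exact: dle_refl. Qed.

Lemma dequiv_sym : symmetric dequiv.
Proof. by move=> A B; apply/asboolP/asboolP => -[]. Qed.

Lemma dequiv_trans : transitive dequiv.
Proof.
move=> B A C /asboolP[AB BA] /asboolP[BC CB]; apply/asboolP.
by split; [exact: dle_trans BC|exact: dle_trans BA].
Qed.

Canonical dequiv_equiv := EquivRel dequiv dequiv_refl dequiv_sym dequiv_trans.

Definition dmul_set (A B : set S) : set S := [set a * b | a in A & b in B].

Definition dinv_set (A : set S) : set S := [set sinv a | a in A].

Lemma directed_mul A B : directed A -> directed B -> directed (dmul_set A B).
Proof.
move=> [[a0 Aa0] dA] [[b0 Bb0] dB]; split.
  by exists (a0 * b0), a0 => //; exists b0.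
move=> _ _ [a Aa [b Bb <-]] [a' Aa' [b' Bb' <-]].
have [c [Ac ca ca']] := dA _ _ Aa Aa'; have [d [Bd db db']] := dB _ _ Bb Bb'.
by exists (c * d); split; [exists c => //; exists d|exact: nat_le_mul..].
Qed.

Lemma directed_inv A : directed A -> directed (dinv_set A).
Proof.
move=> [[a0 Aa0] dA]; split; first by exists (sinv a0), a0.
move=> _ _ [a Aa <-] [b Ab <-]; have [c [Ac ca cb]] := dA _ _ Aa Ab.
by exists (sinv c); split; [exists c|exact: nat_le_inv..].
Qed.

Lemma directed1 (x : S) : directed [set x].
Proof. by split=> [|a b -> ->]; [exists x|exists x]. Qed.

Definition dmul (A B : dset) : dset := mk_dset (directed_mul (dsetP A) (dsetP B)).
Definition dinv (A : dset) : dset := mk_dset (directed_inv (dsetP A)).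

Lemma dle_mul (A A' B B' : set S) :
  dle A A' -> dle B B' -> dle (dmul_set A B) (dmul_set A' B').
Proof.
move=> AA BB _ [a' /AA[a Aa aa'] [b' /BB[b Bb bb'] <-]].
by exists (a * b); [exists a => //; exists b|exact: nat_le_mul].
Qed.

Lemma dle_inv (A B : set S) : dle A B -> dle (dinv_set A) (dinv_set B).
Proof.
move=> AB _ [b /AB[a Aa ab] <-].
by exists (sinv a); [exists a|exact: nat_le_inv].
Qed.

End Directed.

(* The semigroup of classes of directed sets, written O(Gamma) in the
   literature; that its natural order is induced by [dle] is [cls_le]. *)
Definition dirO (S : invSemigroupType) : Type := {eq_quot @dequiv S}.

Section OSemigroup.
Variable S : invSemigroupType.
Implicit Types A B C : dset S.

HB.instance Definition _ := Choice.on (dirO S).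

Definition cls A : dirO S := \pi_({eq_quot @dequiv S}) A.

Definition O_repr (X : dirO S) : dset S := repr (X : {eq_quot @dequiv S}).

Lemma O_reprK X : cls (O_repr X) = X.
Proof. exact: reprK. Qed.

Lemma cls_eq A B : cls A = cls B <-> dle A B /\ dle B A.
Proof. by split=> [/eqmodP/asboolP//|h]; apply/eqmodP/asboolP. Qed.

Lemma repr_cls A : dle (O_repr (cls A)) A /\ dle A (O_repr (cls A)).
Proof. by apply/cls_eq; exact: O_reprK. Qed.

Lemma cls_ind (P : dirO S -> Prop) : (forall A, P (cls A)) -> forall X, P X.
Proof. by move=> h X; rewrite -(O_reprK X). Qed.

Definition Omul (X Y : dirO S) : dirO S := cls (dmul (O_repr X) (O_repr Y)).
Definition Oinv (X : dirO S) : dirO S := cls (dinv (O_repr X)).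

Lemma Omul_cls A B : Omul (cls A) (cls B) = cls (dmul A B).
Proof.
have [A1 A2] := repr_cls A; have [B1 B2] := repr_cls B.
by apply/cls_eq; split; exact: dle_mul.
Qed.

Lemma Oinv_cls A : Oinv (cls A) = cls (dinv A).
Proof. by have [A1 A2] := repr_cls A; apply/cls_eq; split; exact: dle_inv. Qed.

Lemma OmulA : associative Omul.
Proof.
elim/cls_ind => A; elim/cls_ind => B; elim/cls_ind => C.
rewrite !Omul_cls; apply/cls_eq; split.
  move=> _ [_ [a Aa [b Bb <-]] [c Cc <-]]; exists (a * b * c) => //.
  by exists a => //; exists (b * c); [exists b => //; exists c|rewrite mulgA].
move=> _ [a Aa [_ [b Bb [c Cc <-]] <-]]; exists (a * (b * c)) => //.
by exists (a * b); [exists a => //; exists b|exists c; rewrite ?mulgA].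
Qed.

HB.instance Definition _ := isSemigroup.Build (dirO S) OmulA.

Lemma clsM A B : cls A * cls B = cls (dmul A B).
Proof. exact: Omul_cls. Qed.

Lemma dle_mulVg A : dle (dmul (dmul A (dinv A)) A) A /\
                    dle A (dmul (dmul A (dinv A)) A).
Proof.
split.
  move=> a Aa; exists (a * sinv a * a); last by rewrite mulgKs.
  exists (a * sinv a); last by exists a.
  by exists a => //; exists (sinv a) => //; exists a.
move=> _ [_ [a Aa [_ [b Ab <-] <-]] [c Ac <-]].
have [d [Ad da db]] := (dsetP A).2 _ _ Aa Ab.
have [e [Ae ed ec]] := (dsetP A).2 _ _ Ad Ac.
exists e => //; rewrite -[e]mulgKs; apply: nat_le_mul => //.
by apply: nat_le_mul; [|apply: nat_le_inv]; exact: nat_le_trans ed _.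
Qed.

Lemma OmulgKs (X : dirO S) : X * Oinv X * X = X.
Proof.
by elim/cls_ind: X => A; rewrite Oinv_cls !clsM; apply/cls_eq/dle_mulVg.
Qed.

Lemma OinvK : involutive Oinv.
Proof.
elim/cls_ind => A; rewrite !Oinv_cls; apply/cls_eq; split.
  by move=> a Aa; exists a => //; exists (sinv a); [exists a|rewrite sinvK].
by move=> _ [_ [a Aa <-] <-]; exists a => //; rewrite sinvK.
Qed.

Lemma OmulsKg (X : dirO S) : Oinv X * X * Oinv X = Oinv X.
Proof. by rewrite -{2}(OinvK X) OmulgKs. Qed.

Lemma idem_cls A (a : S) : idem (cls A) -> (A : set S) a ->
  exists e, [/\ (A : set S) e, idem e & e \prec a].
Proof.
rewrite /idem clsM => /cls_eq[AAA AAA'] Aa.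
have [_ [b Ab [c Ac <-]] bca] := AAA _ Aa.
have [d [Ad db dc]] := (dsetP A).2 _ _ Ab Ac.
have AAdd : (dmul A A : set S) (d * d) by exists d => //; exists d.
have [g Ag gdd] := AAA' _ AAdd.
have [f [Af fg fd]] := (dsetP A).2 _ _ Ag Ad.
have fdd : f \prec d * d := nat_le_trans fg gdd.
have fa : f \prec a by apply: nat_le_trans bca; apply: nat_le_trans fdd (nat_le_mul db dc).
exists f; split => //.
have fE2 := (nat_leE' _ _).1 fd; have fE3 := (nat_leE' _ _).1 fdd.
have df : d * f = f by rewrite {1}fE2 [LHS]mulgA -fE3.
have /nat_leE fE4 := fd.
by rewrite /idem {1}fE4 -!mulgA df mulgA mulgKs.
Qed.

Lemma OidemC (X Y : dirO S) : idem X -> idem Y -> X * Y = Y * X.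
Proof.
elim/cls_ind: X => A; elim/cls_ind: Y => B; move=> iA iB.
have aux C D : idem (cls C) -> idem (cls D) -> dle (dmul C D) (dmul D C).
  move=> iC iD _ [d Dd [c Cc <-]].
  have [e [Ce ee ec]] := idem_cls iC Cc; have [f [Df ff fd]] := idem_cls iD Dd.
  exists (e * f); first by exists e => //; exists f.
  by rewrite (idemC ee ff); exact: nat_le_mul.
by rewrite !clsM; apply/cls_eq; split; exact: aux.
Qed.

HB.instance Definition _ := Semigroup_isInverse.Build (dirO S) OmulgKs OmulsKg
  (comm_idem_inv_uniq OmulgKs OmulsKg OidemC).

Lemma clsV A : sinv (cls A) = cls (dinv A).
Proof. exact: Oinv_cls. Qed.

Lemma cls_le A B : cls A \prec cls B <-> dle A B.
Proof.
rewrite nat_leE clsV (clsM A (dinv A)) clsM cls_eq; split.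
  move=> [h _] b Bb.
  have [a0 Aa0] := (dsetP A).1.
  have AAB : (dmul (dmul A (dinv A)) B : set S) (a0 * sinv a0 * b).
    exists (a0 * sinv a0); last by exists b.
    by exists a0 => //; exists (sinv a0) => //; exists a0.
  have [a Aa ab] := h _ AAB; exists a => //; apply: nat_le_trans ab _.
  exact/nat_le_mull/idem_mulgs.
move=> AB; split.
  move=> _ [_ [a Aa [_ [a' Aa' <-] <-]] [b Bb <-]].
  have [c Ac cb] := AB _ Bb.
  have [d [Ad da da']] := (dsetP A).2 _ _ Aa Aa'.
  have [e [Ae ed ec]] := (dsetP A).2 _ _ Ad Ac.
  exists e => //; rewrite -[e]mulgKs; apply: nat_le_mul.
    apply: nat_le_mul; first exact: nat_le_trans ed da.
    exact: nat_le_inv (nat_le_trans ed da').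
  exact: nat_le_trans ec cb.
move=> a Aa; have [b Bb] := (dsetP B).1; have [c Ac cb] := AB _ Bb.
have [d [Ad da dc]] := (dsetP A).2 _ _ Aa Ac.
exists (d * sinv d * b).
  exists (d * sinv d); last by exists b.
  by exists d => //; exists (sinv d) => //; exists d.
have /nat_leE <- : d \prec b by exact: nat_le_trans dc cb.
by [].
Qed.

Definition cls1 (x : S) : dirO S := cls (mk_dset (directed1 x)).

Lemma cls_le1 A x : cls A \prec cls1 x <-> exists2 a, (A : set S) a & a \prec x.
Proof. by rewrite cls_le; split=> [h|h _ ->//]; exact: h. Qed.

Lemma cls1_le x y : cls1 x \prec cls1 y <-> x \prec y.
Proof. by rewrite cls_le1; split=> [[_ ->]|]//; exists x. Qed.

End OSemigroup.

(* The product [gmul x y] is only meaningful when [gcomp x y] holds. *)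
HB.mixin Record isGroupoid G := {
  gcomp : G -> G -> Prop;
  gmul : G -> G -> G;
  ginv : G -> G;
  ginvK : involutive ginv;
  gcompM : forall x y z : G, gcomp x y -> gcomp y z ->
    gcomp (gmul x y) z /\ gcomp x (gmul y z);
  gmulA : forall x y z : G, gcomp x y -> gcomp y z ->
    gmul (gmul x y) z = gmul x (gmul y z);
  gcompV : forall x : G, gcomp x (ginv x);
  gmulKl : forall x y : G, gcomp x y -> gmul (ginv x) (gmul x y) = y;
  gmulKr : forall x y : G, gcomp x y -> gmul (gmul x y) (ginv y) = x
}.

#[short(type="groupoidType")]
HB.structure Definition Groupoid := {G of isGroupoid G}.

Definition subgroupoid (G : groupoidType) (H : set G) : Prop :=
  (forall x, H x -> H (ginv x)) /\
  (forall x y, H x -> H y -> gcomp x y -> H (gmul x y)).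

(* Here a unit is an element of the form x^-1 x. Units of a subgroupoid H; the units of G itself are [units [set: G]]. *)
Definition units (G : groupoidType) (H : set G) : set G :=
  [set gmul (ginv x) x | x in H].

Section InvSemigroupGroupoid.
Variable S : invSemigroupType.
Implicit Types x y z : S.

Definition icomp x y : Prop := sinv x * x = y * sinv y.

Lemma icomp_dom x y : icomp x y -> (x * y) * sinv (x * y) = x * sinv x.
Proof.
move=> xy; rewrite sinvM.
have -> : x * y * (sinv y * sinv x) = x * (y * sinv y) * sinv x.
  by rewrite !mulgA.
by rewrite -xy !mulgA mulgKs.
Qed.

Lemma icomp_ran x y : icomp x y -> sinv (x * y) * (x * y) = sinv y * y.
Proof.
move=> xy; rewrite sinvM.
have -> : sinv y * sinv x * (x * y) = sinv y * (sinv x * x) * y.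
  by rewrite !mulgA.
by rewrite xy !mulgA mulsKg.
Qed.

Lemma icompM x y z : icomp x y -> icomp y z ->
  icomp (x * y) z /\ icomp x (y * z).
Proof.
by move=> xy yz; rewrite /icomp (icomp_ran xy) (icomp_dom yz).
Qed.

Lemma imulA x y z : icomp x y -> icomp y z -> x * y * z = x * (y * z).
Proof. by rewrite mulgA. Qed.

Lemma icompV x : icomp x (sinv x).
Proof. by rewrite /icomp sinvK. Qed.

Lemma imulKl x y : icomp x y -> sinv x * (x * y) = y.
Proof. by move=> xy; rewrite mulgA xy mulgKs. Qed.

Lemma imulKr x y : icomp x y -> x * y * sinv y = x.
Proof. by move=> xy; rewrite -mulgA -xy mulgA mulgKs. Qed.

End InvSemigroupGroupoid.

Definition Gu (S : invSemigroupType) : Type := dirO S.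

Section Gu.
Variable S : invSemigroupType.

HB.instance Definition _ := InvSemigroup.on (Gu S).

HB.instance Definition _ := isGroupoid.Build (Gu S)
  (@sinvK (dirO S)) (@icompM (dirO S)) (@imulA (dirO S)) (@icompV (dirO S))
  (@imulKl (dirO S)) (@imulKr (dirO S)).

(* U_{x; x_1, ..., x_n}, where s is the list of the x_i. *)
Definition basic_open (x : S) (s : seq S) : set (Gu S) :=
  [set X : dirO S | X \prec cls1 x /\ forall y, y \in s -> ~ X \prec cls1 y].

Definition Gu_base : set (set (Gu S)) :=
  [set U | exists x s, (forall y, y \in s -> y \prec x) /\ U = basic_open x s].

Lemma Gu_base_cover : \bigcup_(U in Gu_base) U = setT.
Proof.
apply/seteqP; split=> // X _; elim/cls_ind: X => A.
have [a Aa] := (dsetP A).1.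
exists (basic_open a [::]); first by exists a, [::].
by split => //; apply/cls_le1; exists a.
Qed.

Lemma nat_le_meet (x y z : S) : y \prec x -> z \prec x ->
  exists w, [/\ w \prec y, w \prec z &
    forall v, v \prec y -> v \prec z -> v \prec w].
Proof.
move=> /nat_leEl[e ee ->] /nat_leEl[f ff ->].
exists (e * f * x); split.
- by rewrite (idemC ee ff) -mulgA; exact: nat_le_mull.
- by rewrite -mulgA; exact: nat_le_mull.
move=> v /nat_leEl[g gg vE] /nat_leEl[h hh vE'].
apply/nat_leEl; exists (g * h); first exact: idem_mul_idem.
have ev : e * v = v by rewrite vE !mulgA (idemC ee gg) -(mulgA g e e) ee.
have hv : h * v = v by rewrite vE' !mulgA hh.
have gv : g * v = v by rewrite vE !mulgA gg.
rewrite !mulgA -(mulgA g h e) (idemC hh ee) !mulgA.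
have -> : g * e * h * f * x = g * (e * (h * (f * x))) by rewrite !mulgA.
by rewrite -vE' ev gv.
Qed.

Lemma basic_open_refine (A : dset S) (x a : S) (s : seq S) :
  (forall y, y \in s -> y \prec x) -> basic_open x s (cls A) ->
  (A : set S) a -> a \prec x ->
  exists t, [/\ forall y, y \in t -> y \prec a,
    forall y, y \in t -> ~ cls A \prec cls1 y
    & basic_open a t `<=` basic_open x s].
Proof.
move=> sx [_ sA] Aa ax.
have mP y : exists w, y \in s -> [/\ w \prec a, w \prec y &
    forall v, v \prec a -> v \prec y -> v \prec w].
  have [ys|ys] := boolP (y \in s); last by exists a.
  by have [w wP] := nat_le_meet ax (sx _ ys); exists w.
have [m {}mP] := choice mP.
exists (map m s); split.
- by move=> _ /mapP[y /mP[? _ _] ->].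
- move=> _ /mapP[y ys ->] Am; have [_ my _] := mP _ ys.
  by apply: (sA _ ys); apply: nat_le_trans Am _; exact/cls1_le.
elim/cls_ind => B -[/cls_le1[b Bb ba] tB]; split.
  by apply/cls_le1; exists b => //; exact: nat_le_trans ba ax.
move=> y ys /cls_le1[c Bc cy]; apply: (tB (m y)); first exact: map_f.
have [d [Bd db dc]] := (dsetP B).2 _ _ Bb Bc.
apply/cls_le1; exists d => //; have [_ _] := mP _ ys; apply.
  exact: nat_le_trans db ba.
exact: nat_le_trans dc cy.
Qed.

Lemma Gu_base_join (U V : set (Gu S)) (X : Gu S) :
  Gu_base U -> Gu_base V -> U X -> V X ->
  exists W, [/\ Gu_base W, W X & W `<=` U `&` V].
Proof.
elim/cls_ind: X => A [x [s [sx ->]]] [y [t [ty ->]]] UA VA.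
have /cls_le1[a Aa ax] := UA.1; have /cls_le1[b Ab yb] := VA.1.
have [c [Ac ca cb]] := (dsetP A).2 _ _ Aa Ab.
have [s' [s'c s'A s's]] := basic_open_refine sx UA Ac (nat_le_trans ca ax).
have [t' [t'c t'A t't]] := basic_open_refine ty VA Ac (nat_le_trans cb yb).
exists (basic_open c (s' ++ t')); split.
- exists c, (s' ++ t'); split=> // w; rewrite mem_cat => /orP[]; [exact: s'c|exact: t'c].
- split; first by apply/cls_le1; exists c.
  by move=> w; rewrite mem_cat => /orP[]; [exact: s'A|exact: t'A].
move=> Y [Yc Yw]; split; [apply: s's|apply: t't]; split=> // w ws.
  by apply: Yw; rewrite mem_cat ws.
by apply: Yw; rewrite mem_cat ws orbT.
Qed.

HB.instance Definition _ := isBaseTopological.Build (Gu S)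
  Gu_base_cover Gu_base_join.

Definition Gm : set (Gu S) := [set X : dirO S | minimal X].

Lemma Gm_subgroupoid : subgroupoid Gm.
Proof.
split=> [X|X Y mX _ XY]; first exact: minimal_inv.
exact: (@minimal_mul (dirO S) X Y).
Qed.

End Gu.

Arguments Gm : clear implicits.

(* Main.v *)
Require Import Defs.
From mathcomp Require Import all_boot.
From mathcomp Require Import all_classical topology.

Local Open Scope classical_set_scope.

(* Let X be a non-minimal unit. If X is zero, {X} = U_0 is open and misses every
   minimal element. Otherwise pick a nonzero Y strictly below X and idempotents
   q \prec p of Gamma with X \prec p, Y \prec q but not X \prec q. Condition (T)
   for q \prec p yields p_1, ..., p_n, and X lies in U_{p; p_1, ..., p_n, q}:
   X \prec p_j \prec q is excluded, and X \prec p_j with p_j q = 0 would give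
   Y \prec p_j q = 0. A minimal unit Z in that open set would satisfy Z p_j = 0 and
   Z q = 0, so some nonzero idempotent c \prec p annihilates p_1, ..., p_n, q,
   contradicting p < (p_1, ..., p_n, q). *)

Section InverseSemigroup.
Set Implicit Arguments.
Unset Strict Implicit.
Variable S : invSemigroupType.
Implicit Types e f r x y z : S.
Local Open Scope group_scope.

(** The product [e * f] is a nonzero element below [e], so minimality makes it [e]. Used in
    contrapositive form: a minimal idempotent not below [f] is orthogonal to [f]. *)
Lemma minimal_idem_le e f : minimal e -> idem e -> idem f ->
  ~ is_zero (e * f) -> e \prec f.
Proof.
move=> [_ me] ee ff ef0; rewrite -(me _ (nat_le_mulr e ff) ef0).
exact: nat_le_mull.
Qed.

Lemma trapped_annihilator (e c : S) (s : seq S) : trapped e s -> c \prec e -> idem c ->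
  (forall r, r \in s -> is_zero (c * r)) -> is_zero c.
Proof.
move=> tr ce cc cs; apply: contrapT => c0.
have [z [w [z0 ws zc zw]]] := tr c ce c0; apply: z0.
(* Being below [c], [z] is idempotent, so [z = z * z \prec c * w], which is zero. *)
have zz := nat_le_idem zc cc.
by apply: (is_zero_le (cs w ws)); rewrite -[z in X in X \prec _]zz; exact: nat_le_mul.
Qed.

End InverseSemigroup.

Section DirectedClasses.
Set Implicit Arguments.
Unset Strict Implicit.
Variable S : invSemigroupType.
Implicit Types e f r x y z : S.
Local Open Scope group_scope.

Lemma cls1M x y : cls1 x * cls1 y = cls1 (x * y).
Proof.
rewrite clsM; apply/cls_eq; split=> [_ ->|_ [_ -> [_ -> <-]]]; exists (x * y) => //.
by exists x => //; exists y.
Qed.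

Lemma idem_cls1 e : idem e -> idem (cls1 e).
Proof. by rewrite /idem cls1M => ->. Qed.

Lemma is_zero_cls (A : dset S) (z : S) : is_zero z ->
  is_zero (cls A) <-> exists2 a, (A : set S) a & is_zero a.
Proof.
move=> z0; split=> [/(_ (cls1 z))/cls_le1[a Aa az]|[a Aa a0]].
  by exists a => //; exact: is_zero_le az.
elim/cls_ind => B; apply/cls_le => b _; exists a => //; exact: a0.
Qed.

Lemma is_zero_cls1 x : (exists z : S, is_zero z) -> is_zero (cls1 x) <-> is_zero x.
Proof.
move=> [z z0]; rewrite /cls1 (is_zero_cls _ z0).
by split=> [[_ ->]|]//; exists x.
Qed.

Lemma idem_cls_le1 (X : dirO S) x : idem X -> X \prec cls1 x ->
  exists e, [/\ idem e, e \prec x & X \prec cls1 e].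
Proof.
elim/cls_ind: X => A iA /cls_le1[a Aa ax].
have [e [Ae ee ea]] := idem_cls iA Aa.
exists e; split=> //; first exact: nat_le_trans ea ax.
by apply/cls_le1; exists e.
Qed.

(** Brings orthogonality from [dirO S] down to [S]: [Z * cls1 r] vanishes because one member of a
    representative kills [r], and directedness merges the members found for the finitely many
    [r]. *)
Lemma common_annihilator (Z : dirO S) e (s : seq S) : (exists z : S, is_zero z) ->
  idem e -> idem Z -> Z \prec cls1 e ->
  (forall r, r \in s -> is_zero (Z * cls1 r)) ->
  exists c, [/\ idem c, c \prec e, Z \prec cls1 c & forall r, r \in s -> is_zero (c * r)].
Proof.
move=> [z z0]; elim/cls_ind: Z => C ee iC Ce.
elim: s => [_|r s IH Cs]; first by exists e.
have [r'|c [cc ce /cls_le1[d Cd dc] cs]] := IH.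
  by move=> r's; apply: Cs; rewrite inE r's orbT.
have := Cs r (mem_head _ _).
rewrite clsM (is_zero_cls _ z0) => -[_ [b Cb [_ -> <-]] br].
have [b' [Cb' b'b b'd]] := (dsetP C).2 _ _ Cb Cd.
have b'c := nat_le_trans b'd dc.
exists b'; split.
- exact: nat_le_idem b'c cc.
- exact: nat_le_trans b'c ce.
- by apply/cls_le1; exists b'.
move=> t; rewrite inE => /orP[/eqP ->|ts].
  exact: is_zero_le br (nat_le_mul b'b (nat_le_refl r)).
exact: is_zero_le (cs t ts) (nat_le_mul b'c (nat_le_refl t)).
Qed.

Lemma trapped_minimal (Z : dirO S) e (s : seq S) : (exists z : S, is_zero z) ->
  idem e -> (forall r, r \in s -> idem r) -> trapped e s ->
  idem Z -> minimal Z -> ~ basic_open e s Z.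
Proof.
move=> ex0 ee si tr iZ mZ [Ze Zs].
have [r rs|c [cc ce Zc cs]] := common_annihilator (s := s) ex0 ee iZ Ze.
  apply: contrapT => Zr; apply: (Zs r rs).
  exact: minimal_idem_le mZ iZ (idem_cls1 (si r rs)) Zr.
apply: mZ.1; apply: is_zero_le Zc; apply/(is_zero_cls1 _ ex0).
exact: trapped_annihilator tr ce cc cs.
Qed.

Lemma not_minimal (X : dirO S) : ~ is_zero X -> ~ minimal X ->
  exists Y : dirO S, [/\ Y \prec X, ~ is_zero Y & ~ X \prec Y].
Proof.
move=> X0 nX; apply: contrapT => nY; apply: nX; split=> // Y YX Y0.
apply: nat_le_anti => //; apply: contrapT => XY.
by apply: nY; exists Y.
Qed.

(** Failure of [X \prec Y] shows at a single member [b] of a representative of [Y]; [q] is an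
    idempotent member below both [b] and [p]. *)
Lemma separating_idem (X Y : dirO S) : idem X -> Y \prec X -> ~ X \prec Y ->
  exists p q, [/\ idem p, idem q & q \prec p] /\
    [/\ X \prec cls1 p, Y \prec cls1 q & ~ X \prec cls1 q].
Proof.
elim/cls_ind: X => A; elim/cls_ind: Y => B iA BA AB.
have iB := nat_le_idem BA iA.
have [b Bb Ab] : exists2 b, (B : set S) b & ~ cls A \prec cls1 b.
  apply: contrapT => nb; apply/AB/cls_le => b Bb.
  by apply/cls_le1; apply: contrapT => nab; apply: nb; exists b.
have [a Aa] := (dsetP A).1; have [p [Ap pp _]] := idem_cls iA Aa.
have [b' Bb' b'p] := (cls_le _ _).1 BA _ Ap.
have [d [Bd db db']] := (dsetP B).2 _ _ Bb Bb'.
have [q [Bq qq qd]] := idem_cls iB Bd.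
exists p, q; split; split=> //.
- exact: nat_le_trans (nat_le_trans qd db') b'p.
- by apply/cls_le1; exists p.
- by apply/cls_le1; exists q.
move=> Aq; apply: Ab; apply: nat_le_trans Aq _; apply/cls1_le.
exact: nat_le_trans qd db.
Qed.

Lemma not_minimal_nbhs (X : dirO S) : condition_T S -> idem X -> ~ minimal X ->
  exists p s, [/\ forall r, r \in s -> r \prec p, basic_open p s X &
    forall Z : dirO S, idem Z -> minimal Z -> ~ basic_open p s Z].
Proof.
move=> [ex0 T] iX nX; case: (pselect (is_zero X)) => [X0|X0].
  have [z z0] := ex0.
  (* Everything below [cls1 z] is zero, so nothing has to be removed from [U_z]. *)
  exists z, [::]; split=> // Z iZ mZ [Zz _].
  by apply: mZ.1; apply: is_zero_le Zz; apply/is_zero_cls1.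
have [Y [YX Y0 XY]] := not_minimal X0 nX.
have [p [q [[pp qq qp] [Xp Yq Xq]]]] := separating_idem iX YX XY.
have [ps [psp tr psq]] := T p q pp qq qp.
have psqI r : r \in rcons ps q -> idem r /\ r \prec p.
  by rewrite mem_rcons inE => /orP[/eqP ->|/psp].
exists p, (rcons ps q); split.
- by move=> r /psqI[].
- split=> // r; rewrite mem_rcons inE => /orP[/eqP ->//|rps Xr].
  have [rq|rq0] := psq r rps.
    by apply: Xq; apply: nat_le_trans Xr _; apply/cls1_le.
  apply: Y0; apply: (@is_zero_le _ _ (cls1 (r * q))).
    exact/is_zero_cls1.
  (* As [Y] is idempotent, [Y = Y * Y \prec cls1 r * cls1 q]. *)
  rewrite -cls1M -[X in X \prec _](nat_le_idem YX iX).
  exact: nat_le_mul (nat_le_trans YX Xr) Yq.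
move=> Z iZ mZ; apply: trapped_minimal tr iZ mZ => // r /psqI[] //.
Qed.

End DirectedClasses.

Lemma Gu_base_open (S : invSemigroupType) (U : set (Gu S)) : Gu_base U -> open U.
Proof.
move=> bU; exists [set U]; first by move=> _ ->.
by rewrite bigcup_set1.
Qed.

Lemma units_idem (S : invSemigroupType) (H : set (Gu S)) (X : dirO S) :
  units H X -> idem X.
Proof. by move=> [Y _ <-]; exact: idem_mulsg. Qed.

Lemma units_GmE (S : invSemigroupType) (X : dirO S) :
  units (Gm S) X <-> idem X /\ minimal X.
Proof.
split=> [uX|[iX mX]].
  split; first exact: units_idem uX.
  (* The unit is a composable product with minimal first factor [sinv Y]. *)
  have [Y mY <-] := uX; apply: minimal_mul (minimal_inv mY).
  by rewrite sinvK.
exists X => //; change ((sinv X * X)%g = X).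
by rewrite idem_sinv.
Qed.

Theorem proposition6p6 (S : invSemigroupType) (hT : condition_T S) :
  closed ([set u | units (Gm S) (set_val u)]
            : set (set_type (units [set: Gu S]))).
Proof.
move=> u clu; apply/units_GmE; have iu := units_idem (set_valP u).
split=> //; apply: contrapT => nu.
have [p [s [sp us nZ]]] := not_minimal_nbhs hT iu nu.
have oU : open (basic_open p s) by apply: Gu_base_open; exists p, s.
(* Closedness is relative to the space of units, so the open set is pulled back along the
   inclusion. *)
have nU : nbhs u (set_val @^-1` basic_open p s).
  exact/(@initial_continuous _ _ set_val)/open_nbhs_nbhs.
by have [v [/units_GmE[iv mv] Uv]] := clu _ nU; exact: nZ Uv.
Qed.
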